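(* Let $d\ge 1$ and let $f=\bigoplus_{0\le i\le d} f_i\otimes y^{\otimes i}$, where the $f_i$ are tropical polynomials in the variables $x_1,\dots,x_n$ with integer coefficients (some terms $f_i$ with $i<d$ may be absent, i.e. $f_i=\infty$, but $f_d\neq\infty$ and at least one $f_i$ with $i<d$ is not $\infty$). Then $$y=\bigoplus_{1\le i\le d}(f_{d-i}\oslash f_d)^{\otimes(1/i)},$$ i.e. classically the function $y(\mathbf x)=\min_{1\le i\le d}\frac{f_{d-i}(\mathbf x)-f_d(\mathbf x)}{i}$ on $\mathbb{R}^n$, is a tropical Newton-Puiseux rational function, it is a resolution of $f$, and it is the minimal resolution of $f$ among tropical Newton-Puiseux rational functions. In particular, $f$ has a resolution in tropical Newton-Puiseux rational functions.
   Context: In the tropical semiring $\oplus$ denotes $\min$, $\otimes$ denotes classical addition $+$, and $\oslash$ denotes classical subtraction; tropical power $z^{\otimes r}$ is classically $r\cdot z$ for $r\in\mathbb{Q}$. The tropical zero is $\infty$. A tropical polynomial in $x_1,\dots,x_n$ is a finite nonempty expression $\bigoplus_I a_I\otimes x^{\otimes I}$ with $I=(i_1,\dots,i_n)$ a multiindex of nonnegative integers; it is regarded as the function $\mathbf x\mapsto\min_I\{a_I+i_1x_1+\cdots+i_nx_n\}$ on $\mathbb{R}^n$. A tropical Newton-Puiseux polynomial is a finite nonempty expression $\bigoplus_I a_I\otimes x^{\otimes I}$ with $I\in\mathbb{Q}^n$, $a_I\in\mathbb{Q}$, regarded as a function in the same way. A tropical Newton-Puiseux rational function is a function of the form $g\oslash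 h$, i.e. $g-h$, where $g,h$ are tropical Newton-Puiseux polynomials. A tropical Newton-Puiseux rational function $y:\mathbb{R}^n\to\mathbb{R}$ is a resolution of $f$ if for every $\mathbf x\in\mathbb{R}^n$ the minimum of the values $f_i(\mathbf x)+i\cdot y(\mathbf x)$, $0\le i\le d$, is attained for at least two different indices $i$. A resolution $y$ is minimal if $y(\mathbf x)\le z(\mathbf x)$ for every resolution $z$ and every $\mathbf x\in\mathbb{R}^n$. *)

(* Defs.v *)
From HB Require Import structures.
From mathcomp Require Import all_boot all_order all_algebra.
From mathcomp Require Import reals constructive_ereal.

Set Implicit Arguments.
Unset Strict Implicit.
Unset Printing Implicit Defensive.

Import Order.TTheory GRing.Theory Num.Theory.
Local Open Scope ring_scope.

(* A finite nonempty tropical sum of terms in T is a pair (t0, ts), standing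
   for t0 (+) t1 (+) ... (+) tk.  Two terms may carry the same exponent; this
   does not enlarge the class of functions, since only the one with the least
   coefficient matters. *)
Definition tropSum (T : Type) : Type := (T * seq T)%type.

Definition tropSum_eval (R : realType) (T : Type) (ev : T -> R)
    (p : tropSum T) : R :=
  \big[Num.min/ev p.1]_(t <- p.2) ev t.

(* The pair (a, I) stands for the term a (x) x^I, i.e. the affine function
   a + i_1 x_1 + ... + i_n x_n. *)
Definition intMonomial (n : nat) : Type := (int * {ffun 'I_n -> nat})%type.

Definition intMonomial_eval (R : realType) (n : nat) (x : 'rV[R]_n)
    (m : intMonomial n) : R :=
  m.1%:~R + \sum_(j < n) (m.2 j)%:R * x 0 j.

Definition tropPoly (n : nat) : Type := tropSum (intMonomial n).

Definition tropPoly_eval (R : realType) (n : nat) (p : tropPoly n)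
    (x : 'rV[R]_n) : R :=
  tropSum_eval (intMonomial_eval x) p.

Definition ratMonomial (n : nat) : Type := (rat * {ffun 'I_n -> rat})%type.

Definition ratMonomial_eval (R : realType) (n : nat) (x : 'rV[R]_n)
    (m : ratMonomial n) : R :=
  ratr m.1 + \sum_(j < n) ratr (m.2 j) * x 0 j.

Definition npPoly (n : nat) : Type := tropSum (ratMonomial n).

Definition npPoly_eval (R : realType) (n : nat) (p : npPoly n)
    (x : 'rV[R]_n) : R :=
  tropSum_eval (ratMonomial_eval x) p.

Definition is_npRational (R : realType) (n : nat) (y : 'rV[R]_n -> R) : Prop :=
  exists g h : npPoly n, forall x, y x = npPoly_eval g x - npPoly_eval h x.

(* f : 'I_d.+1 -> option (tropPoly n) encodes the tropical polynomial
   f_0 (+) f_1 (x) y (+) ... (+) f_d (x) y^d; None is an absent coefficient,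
   whose value is the tropical zero +oo. *)
Definition coef_eval (R : realType) (n : nat) (c : option (tropPoly n))
    (x : 'rV[R]_n) : \bar R :=
  if c is Some p then (tropPoly_eval p x)%:E else +oo%E.

Definition term_value (R : realType) (n d : nat)
    (f : 'I_d.+1 -> option (tropPoly n)) (y : 'rV[R]_n -> R)
    (x : 'rV[R]_n) (i : 'I_d.+1) : \bar R :=
  (coef_eval (f i) x + (i%:R * y x)%:E)%E.

Definition attains_min (R : realType) (I : Type) (v : I -> \bar R) (i : I) :
    Prop :=
  forall k : I, (v i <= v k)%E.

Definition is_resolution (R : realType) (n d : nat)
    (f : 'I_d.+1 -> option (tropPoly n)) (y : 'rV[R]_n -> R) : Prop :=
  is_npRational y /\
  forall x : 'rV[R]_n, exists i j : 'I_d.+1,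
    [/\ i != j, attains_min (term_value f y x) i
      & attains_min (term_value f y x) j].

Definition is_minimal_resolution (R : realType) (n d : nat)
    (f : 'I_d.+1 -> option (tropPoly n)) (y : 'rV[R]_n -> R) : Prop :=
  is_resolution f y /\
  forall z : 'rV[R]_n -> R, is_resolution f z -> forall x, y x <= z x.

(* The minimum over 1 <= i <= d of (f_(d-i)(x) - f_d(x)) / i; rev_ord i is the
   index d - i.  Terms with f_(d-i) absent have value +oo when f_d is present. *)
Definition resolution_formula (R : realType) (n d : nat)
    (f : 'I_d.+1 -> option (tropPoly n)) (x : 'rV[R]_n) : \bar R :=
  (\big[Order.min/+oo]_(i < d.+1 | (0 < i)%N)
     ((i%:R^-1)%:E *
      (coef_eval (f (rev_ord i)) x - coef_eval (f ord_max) x)))%E.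

(* Main.v *)
Require Import Defs.
From HB Require Import structures.
From mathcomp Require Import all_boot all_order all_algebra.
From mathcomp Require Import reals constructive_ereal.
From mathcomp Require Import lra.

Import Order.TTheory GRing.Theory Num.Theory.
Local Open Scope ring_scope.

(** Fix a point [x].  For a real [t], the term of index [d] is at most the term
    of index [d - i] exactly when [t] is at most
    [s_i := (f_(d-i)(x) - f_d(x)) / i], and likewise for the reverse
    inequalities; see [le_slope] and [slope_le].  This is, up to sign, the slope
    of the segment joining the points of abscissas [d - i] and [d] in the Newton
    diagram of [f].  Let [y(x)] be the least [s_i].  If [t < y(x)], then the term of index [d] is the
    unique least one, so no resolution takes the value [t] at [x].  If
    [t = y(x)], then the term of index [d] is still least, and it is tied with
    the term of index [d - i] for every [i] with [s_i = y(x)].  Hence [y]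
    solves [f] and lies pointwise below every resolution.

    It remains to see that [y] is a Newton-Puiseux rational function.
    Newton-Puiseux polynomials are closed under minimum, sum and multiplication
    by a nonnegative rational, so their differences are closed under minimum,
    by [min (g - h, g' - h') = min (g + h', g' + h) - (h + h')].  Absent
    coefficients contribute infinite slopes, so the induction over the slopes
    ([npRational_or_infty_bigmin]) carries the alternative of a function that is
    infinite everywhere; a present [f_i] with [i < d] excludes it at the end. *)

(** * Newton-Puiseux polynomials and rational functions *)

(** Tropical sums are generated by their terms under minimum, so the closure
    properties below need only be checked on terms and on minima of two
    functions.  [P] is asked to respect pointwise equality in order to avoid
    functional extensionality. *)
Lemma tropSum_eval_ind (R : realType) (X T : Type) (ev : X -> T -> R)
    (P : (X -> R) -> Prop) :
  (forall g h, g =1 h -> P g -> P h) ->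
  (forall t, P (fun x => ev x t)) ->
  (forall g h, P g -> P h -> P (fun x => Num.min (g x) (h x))) ->
  forall p : tropSum T, P (fun x => tropSum_eval (ev x) p).
Proof.
move=> Pext Pterm Pmin [t ts]; elim: ts => [|u ts IHts].
  by apply: Pext (Pterm t) => x; rewrite /tropSum_eval big_nil.
by apply: Pext (Pmin _ _ (Pterm u) IHts) => x; rewrite /tropSum_eval big_cons.
Qed.

Definition is_npPoly (R : realType) (n : nat) (g : 'rV[R]_n -> R) : Prop :=
  exists p : npPoly n, forall x, g x = npPoly_eval p x.

Section NPPoly.
Context {R : realType} {n : nat}.
Implicit Types (g h : 'rV[R]_n -> R) (m : ratMonomial n).

Lemma is_npPoly_ext g h : g =1 h -> is_npPoly R n g -> is_npPoly R n h.
Proof. by move=> gh [p gp]; exists p => x; rewrite -gh. Qed.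

Lemma is_npPoly_monomial m : is_npPoly R n (fun x => ratMonomial_eval x m).
Proof. by exists (m, [::]) => x; rewrite /npPoly_eval /tropSum_eval big_nil. Qed.

Lemma is_npPoly_min g h :
  is_npPoly R n g -> is_npPoly R n h ->
  is_npPoly R n (fun x => Num.min (g x) (h x)).
Proof.
case=> [p gp] [[t ts] hq].
suff [r Er] : is_npPoly R n (fun x => Num.min (npPoly_eval p x)
    (npPoly_eval (t, ts) x)) by exists r => x; rewrite gp hq Er.
exists (p.1, p.2 ++ t :: ts) => x; rewrite /npPoly_eval /tropSum_eval /=.
(* Over the concatenation, the minimum over the right block is the default
   value of the left block.  That default is Num.min a b, where b is the value
   of the second polynomial, once its own default is exchanged with a. *)
have default_out (a b : R) (s : seq (ratMonomial n)) :
    \big[Num.min/Num.min a b]_(u <- s) ratMonomial_eval x u =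
    Num.min (\big[Num.min/a]_(u <- s) ratMonomial_eval x u) b.
  by elim: s => [|u s IHs]; rewrite ?big_nil // !big_cons IHs minA.
rewrite big_cat_nested big_cons.
set a := ratMonomial_eval x p.1; set b := ratMonomial_eval x t.
have swap : Num.min b (\big[Num.min/a]_(u <- ts) ratMonomial_eval x u) =
    Num.min a (\big[Num.min/b]_(u <- ts) ratMonomial_eval x u).
  elim: (ts) => [|u s IHs]; first by rewrite !big_nil minC.
  by rewrite !big_cons minCA IHs minCA.
by rewrite swap default_out.
Qed.

Lemma is_npPoly_ind (P : ('rV[R]_n -> R) -> Prop) :
  (forall g h, g =1 h -> P g -> P h) ->
  (forall m, P (fun x => ratMonomial_eval x m)) ->
  (forall g h, P g -> P h -> P (fun x => Num.min (g x) (h x))) ->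
  forall g, is_npPoly R n g -> P g.
Proof.
move=> Pext Pterm Pmin g [p gp].
apply: (Pext (npPoly_eval p)) => [x|]; first by rewrite gp.
exact: tropSum_eval_ind.
Qed.

Lemma is_npPoly_add g h :
  is_npPoly R n g -> is_npPoly R n h -> is_npPoly R n (fun x => g x + h x).
Proof.
move=> gP; move: g gP h.
apply: is_npPoly_ind => [g g' gg' gP h hP|m|g g' gP g'P h hP].
- by apply: is_npPoly_ext (gP h hP) => x; rewrite gg'.
- apply: is_npPoly_ind => [h h' hh'|m'|h h' hP h'P].
  + by apply: is_npPoly_ext => x; rewrite hh'.
  + apply: is_npPoly_ext
      (is_npPoly_monomial (m.1 + m'.1, [ffun j => m.2 j + m'.2 j])) => x.
    rewrite /ratMonomial_eval /= rmorphD addrACA -big_split /=.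
    by congr (_ + _); apply: eq_bigr => j _; rewrite ffunE rmorphD mulrDl.
  + by apply: is_npPoly_ext (is_npPoly_min _ _ hP h'P) => x; rewrite addr_minr.
- by apply: is_npPoly_ext (is_npPoly_min _ _ (gP h hP) (g'P h hP)) => x;
    rewrite addr_minl.
Qed.

(** Nonnegativity of the scalar is what makes multiplication commute with
    minimum. *)
Lemma is_npPoly_scale (c : rat) g :
  0 <= c -> is_npPoly R n g -> is_npPoly R n (fun x => ratr c * g x).
Proof.
move=> c_ge0; move: g; apply: is_npPoly_ind => [g h gh|m|g h gP hP].
- by apply: is_npPoly_ext => x; rewrite gh.
- apply: is_npPoly_ext
    (is_npPoly_monomial (c * m.1, [ffun j => c * m.2 j])) => x.
  rewrite /ratMonomial_eval /= rmorphM mulrDr mulr_sumr.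
  by congr (_ + _); apply: eq_bigr => j _; rewrite ffunE rmorphM mulrA.
- by apply: is_npPoly_ext (is_npPoly_min _ _ gP hP) => x;
    rewrite minr_pMr // ler0q.
Qed.

Lemma is_npPoly_tropPoly (p : tropPoly n) :
  is_npPoly R n (fun x => tropPoly_eval p x).
Proof.
apply: tropSum_eval_ind; [exact: is_npPoly_ext| |exact: is_npPoly_min].
move=> m; apply: is_npPoly_ext
  (is_npPoly_monomial (m.1%:~R, [ffun j => (m.2 j)%:R])) => x.
rewrite /ratMonomial_eval /intMonomial_eval /= ratr_int.
by congr (_ + _); apply: eq_bigr => j _; rewrite ffunE ratr_nat.
Qed.

Lemma is_npRational_sub g h :
  is_npPoly R n g -> is_npPoly R n h -> is_npRational (fun x => g x - h x).
Proof. by move=> [p gp] [q hq]; exists p, q => x; rewrite gp hq. Qed.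

Lemma is_npRational_min g h :
  is_npRational g -> is_npRational h ->
  is_npRational (fun x => Num.min (g x) (h x)).
Proof.
move=> [p [q gpq]] [p' [q' hpq]].
have np r : is_npPoly R n (npPoly_eval r) by exists r.
have [r [s E]] := is_npRational_sub _ _
  (is_npPoly_min _ _ (is_npPoly_add _ _ (np p) (np q'))
                     (is_npPoly_add _ _ (np p') (np q)))
  (is_npPoly_add _ _ (np q) (np q')).
exists r, s => x; rewrite -E gpq hpq addr_minl.
by congr Num.min; lra.
Qed.

Definition npRational_or_infty (F : 'rV[R]_n -> \bar R) : Prop :=
  (forall x, F x = +oo%E) \/
  exists2 y, is_npRational y & forall x, (y x)%:E = F x.

Lemma npRational_or_infty_bigmin (I : Type) (r : seq I) (P : pred I)
    (F : I -> 'rV[R]_n -> \bar R) :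
  (forall i, P i -> npRational_or_infty (F i)) ->
  npRational_or_infty
    (fun x => \big[Order.min/+oo%E]_(i <- r | P i) F i x).
Proof.
move=> FP; elim: r => [|i r IHr]; first by left=> x; rewrite big_nil.
have [Pi|nPi] := boolP (P i); last first.
  case: IHr => [Einf|[y yP Ey]]; [left=> x|right; exists y => // x];
  by rewrite big_cons (negbTE nPi).
case: (FP i Pi) IHr => [Fi|[y yP Ey]] [Einf|[z zP Ez]].
- by left=> x; rewrite big_cons Pi Fi Einf minxx.
- by right; exists z => // x; rewrite big_cons Pi Fi -Ez min_r ?leey.
- by right; exists y => // x; rewrite big_cons Pi Einf -Ey min_l ?leey.
- right; exists (fun x => Num.min (y x) (z x)); first exact: is_npRational_min.
  by move=> x; rewrite big_cons Pi -Ey -Ez EFin_min.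
Qed.

End NPPoly.

(** * Slopes and comparison of terms *)

Section Slopes.
Context {R : realType} {n d : nat}.
Variables (f : 'I_d.+1 -> option (tropPoly n)) (q : tropPoly n).
Hypothesis fd : f ord_max = Some q.
Implicit Types (x : 'rV[R]_n) (y : 'rV[R]_n -> R) (i : 'I_d.+1).

Definition newton_slope x i : \bar R :=
  ((i%:R^-1)%:E * (coef_eval (f (rev_ord i)) x - coef_eval (f ord_max) x))%E.

Lemma newton_slope_pinfty x i :
  (0 < i)%N -> f (rev_ord i) = None -> newton_slope x i = +oo%E.
Proof.
move=> i_gt0 fi; rewrite /newton_slope fi fd /= addye //.
by rewrite gt0_muley // lte_fin invr_gt0 ltr0n.
Qed.

Lemma newton_slope_fin x i p :
  f (rev_ord i) = Some p ->
  newton_slope x i = ((tropPoly_eval p x - tropPoly_eval q x) / i%:R)%:E.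
Proof. by move=> fi; rewrite /newton_slope fi fd /= -EFinB -EFinM mulrC. Qed.

Lemma rev_ord_natr i : (rev_ord i)%:R = d%:R - i%:R :> R.
Proof. by rewrite /= subSS natrB // -ltnS. Qed.

Lemma le_slope y x i :
  (0 < i)%N ->
  ((y x)%:E <= newton_slope x i)%E =
  (term_value f y x ord_max <= term_value f y x (rev_ord i))%E.
Proof.
move=> i_gt0; case fi: (f (rev_ord i)) => [p|]; last first.
  by rewrite newton_slope_pinfty // /term_value fi /= addye // !leey.
rewrite (newton_slope_fin _ _ _ fi) /term_value fi fd /coef_eval -!EFinD !lee_fin.
by rewrite ler_pdivlMr ?ltr0n // rev_ord_natr; apply/idP/idP => /=; lra.
Qed.

Lemma slope_le y x i :
  (0 < i)%N ->
  (newton_slope x i <= (y x)%:E)%E =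
  (term_value f y x (rev_ord i) <= term_value f y x ord_max)%E.
Proof.
move=> i_gt0; case fi: (f (rev_ord i)) => [p|]; last first.
  by rewrite newton_slope_pinfty // /term_value fi fd /= addye.
rewrite (newton_slope_fin _ _ _ fi) /term_value fi fd /coef_eval -!EFinD !lee_fin.
by rewrite ler_pdivrMr ?ltr0n // rev_ord_natr; apply/idP/idP => /=; lra.
Qed.

Lemma rev_ord_gt0 i : (0 < rev_ord i)%N = (i != ord_max).
Proof. by rewrite /= subSS subn_gt0 ltn_neqAle -(ltnS i) ltn_ord andbT. Qed.

Lemma resolution_formula_le x i :
  (0 < i)%N -> (resolution_formula f x <= newton_slope x i)%E.
Proof. by move=> i_gt0; exact: bigmin_le_cond. Qed.

Lemma newton_slope_npRational i :
  (0 < i)%N -> npRational_or_infty (fun x => newton_slope x i).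
Proof.
move=> i_gt0; case fi: (f (rev_ord i)) => [p|]; last first.
  by left=> x; exact: newton_slope_pinfty.
right; have c_ge0 : 0 <= i%:R^-1 :> rat by rewrite invr_ge0.
have [g [h E]] := is_npRational_sub _ _
  (is_npPoly_scale _ _ c_ge0 (is_npPoly_tropPoly (R := R) p))
  (is_npPoly_scale _ _ c_ge0 (is_npPoly_tropPoly (R := R) q)).
exists (fun x => npPoly_eval g x - npPoly_eval h x); first by exists g, h.
move=> x; rewrite -E (newton_slope_fin _ _ _ fi) -mulrBr mulrC.
by rewrite fmorphV rmorph_nat.
Qed.

(** At the least slope the top term is a least term, tied with the term of
    every index that realizes this slope. *)
Lemma formula_attains_min_twice y x :
  (y x)%:E = resolution_formula f x ->
  exists i j, [/\ i != j, attains_min (term_value f y x) i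
                        & attains_min (term_value f y x) j].
Proof.
move=> Ey.
have max_min : attains_min (term_value f y x) ord_max.
  move=> k; have [->//|k_max] := eqVneq k ord_max.
  rewrite -(rev_ordK k) -le_slope ?rev_ord_gt0 // Ey.
  by apply: resolution_formula_le; rewrite rev_ord_gt0.
have [i i_gt0 Ei] : exists2 i : 'I_d.+1, (0 < i)%N & newton_slope x i = (y x)%:E.
  (* The minimum is finite, hence it is not the default value. *)
  have : resolution_formula f x != +oo%E by rewrite -Ey.
  rewrite Ey /resolution_formula; elim/big_ind: _ => [|a b IHa IHb|i i_gt0 _].
  - by rewrite eqxx.
  - by rewrite minEle; case: ifP.
  - by exists i.
exists ord_max, (rev_ord i); split=> //.
  by rewrite eq_sym -rev_ord_gt0 rev_ordK.
by move=> k; apply: le_trans (max_min k); rewrite -slope_le // Ei.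
Qed.

(** Of two distinct indices of least terms one is not [d], and the slope that
    it determines is at most [z x]. *)
Lemma formula_le_resolution z x :
  is_resolution f z -> (resolution_formula f x <= (z x)%:E)%E.
Proof.
case=> _ /(_ x)[i [j [ij i_min j_min]]].
have [k k_max k_min] :
    exists2 k, k != ord_max & attains_min (term_value f z x) k.
  have [Ei|] := eqVneq i ord_max; last by exists i.
  by exists j; rewrite // eq_sym -Ei.
apply: (@le_trans _ _ (newton_slope x (rev_ord k))).
  by apply: resolution_formula_le; rewrite rev_ord_gt0.
by rewrite slope_le ?rev_ord_gt0 // rev_ordK; exact: k_min.
Qed.

Lemma resolution_formula_npRational i :
  (i < d)%N -> f i <> None ->
  exists2 y : 'rV[R]_n -> R, is_npRational y
    & forall x, (y x)%:E = resolution_formula f x.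
Proof.
move=> i_lt_d; case fi: (f i) => [p|//] _.
have [Einf|//] := npRational_or_infty_bigmin _ (index_enum 'I_d.+1)
  (fun k => (0 < k)%N) (fun k x => newton_slope x k) newton_slope_npRational.
have rev_gt0 : (0 < rev_ord i)%N by rewrite rev_ord_gt0 -val_eqE /= ltn_eqF.
have := resolution_formula_le 0 _ rev_gt0; rewrite [leLHS]Einf.
by rewrite (newton_slope_fin _ _ p) // rev_ordK.
Qed.

End Slopes.

(** * The minimal resolution *)

Theorem mainTheorem1 (R : realType) (n d : nat) (hd : (1 <= d)%N)
    (f : 'I_d.+1 -> option (tropPoly n))
    (hfd : f ord_max <> None)
    (hf : exists i : 'I_d.+1, (i < d)%N /\ f i <> None) :
  (exists y : 'rV[R]_n -> R,
     [/\ forall x : 'rV[R]_n, (y x)%:E = resolution_formula f x,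
         is_npRational y,
         is_resolution f y
       & is_minimal_resolution f y]) /\
  (exists z : 'rV[R]_n -> R, is_resolution f z).
Proof.
case fd: (f ord_max) hfd => [q|//] _; have [i [i_lt_d fi]] := hf.
have [y yP Ey] := resolution_formula_npRational (R := R) _ _ fd i i_lt_d fi.
have y_res : is_resolution f y.
  by split=> // x; exact: formula_attains_min_twice fd y x (Ey x).
split; exists y => //; split=> //; split=> // z z_res x.
by rewrite -lee_fin Ey; exact: formula_le_resolution fd z x z_res.
Qed.
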